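(* Suppose we are given: 1. a sequence of positive integers $J_{n}$, $n\ge1$; 2. vectors $u^{1,1}_{n},u^{1,2}_{n},u^{2,1}_{n},u^{2,2}_{n}\in\mathbb{Z}^{J_{n}}$ for all $n\ge1$; 3. $J_{n+1}\times J_{n}$ matrices $A^{1,1}_{n},A^{1,2}_{n},A^{2,1}_{n},A^{2,2}_{n}$ with strictly positive integer entries, for all $n\ge1$, satisfying, for $i=1,2$, $$\begin{bmatrix} A_{n}^{1,1} & A_{n}^{1,2} \\ A_{n}^{2,1} & A_{n}^{2,2} \end{bmatrix} \begin{bmatrix} u_{n}^{i,1} \\ u_{n}^{i,2} \end{bmatrix} = \begin{bmatrix} u_{n+1}^{i,1} \\ u_{n+1}^{i,2} \end{bmatrix}.$$ Let $(G,G^{+})$ be the dimension group which is the inductive limit of the sequence $$\mathbb{Z}^{J_{1}}\oplus\mathbb{Z}^{J_{1}}\to\mathbb{Z}^{J_{2}}\oplus\mathbb{Z}^{J_{2}}\to\cdots$$ whose $n$-th connecting map is the block matrix $\begin{bmatrix} A_{n}^{1,1} & A_{n}^{1,2} \\ A_{n}^{2,1} & A_{n}^{2,2} \end{bmatrix}$, let $\eta_{n}:\mathbb{Z}^{J_{n}}\oplus\mathbb{Z}^{J_{n}}\to G$ be the canonical map, and let $u^{i}=\eta_{n}(u_{n}^{i,1},u_{n}^{i,2})$ for $i=1,2$ (independent of $n$). Suppose that there are a decreasing sequence of rational numbers $r_{n}$, $n\ge1$, with $2>r_{n}>1$ and limit $1$, and strictly increasing sequences of positive integers $K_{n}$ and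 $l_{n}$, all at least $4$, such that for all $n\ge1$: 4. $$r_{n}^{-1}K_{n}\le u_{n}^{1,1},\,u_{n}^{2,2}\le r_{n}K_{n},\qquad -r_{n}K_{n}\le l_{n}u_{n}^{1,2},\,l_{n}u_{n}^{2,1}\le -r_{n}^{-1}K_{n};$$ 5. for all $1\le j',j''\le J_{n+1}$ and $1\le j\le J_{n}$, $$r_{n}^{-1}A_{n}^{1,1}(j',j)\le l_{n}A_{n}^{2,1}(j'',j)\le r_{n}A_{n}^{1,1}(j',j),$$ $$r_{n}^{-1}A_{n}^{2,2}(j',j)\le l_{n}A_{n}^{1,2}(j'',j)\le r_{n}A_{n}^{2,2}(j',j).$$ Then $(G,G^{+})$ is a simple dimension group with exactly two extremal states $\sigma_{1},\sigma_{2}$ (states being taken with respect to the order unit $u=u^{1}+u^{2}$), and they satisfy $\sigma_{1}(u^{1})=\sigma_{2}(u^{2})=1$ and $\sigma_{2}(u^{1})=\sigma_{1}(u^{2})=0$.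
   Context: For a vector $v\in\mathbb{R}^{I}$ and a real number $r$, $v\le r$ means $v(i)\le r$ for all $i$, and $v\ge r$ means $v(i)\ge r$ for all $i$; ''$a\le b,c\le d$'' means $a\le b\le d$ and $a\le c\le d$. $A(j',j)$ denotes the $(j',j)$ entry of a matrix $A$; elements of $\mathbb{Z}^{J}$ are column vectors. An ordered abelian group is a pair $(G,G^{+})$ with $G$ a (countable) abelian group and $G^{+}\subseteq G$ satisfying $G^{+}+G^{+}\subseteq G^{+}$, $G^{+}-G^{+}=G$, $G^{+}\cap(-G^{+})=\{0\}$. $\mathbb{Z}^{I}$ carries the simplicial order $\mathbb{Z}^{I+}=\{n:n(i)\ge0\text{ for all }i\}$. A dimension group is an inductive limit, in the category of ordered abelian groups, of a sequence of simplicially ordered groups $\mathbb{Z}^{I_{n}}$ with connecting maps given by non-negative integer matrices: $G$ is the inductive limit group and $G^{+}$ is the union of the images of the cones $\mathbb{Z}^{I_{n}+}$ under the canonical maps. An element $u\in G^{+}$ is an order unit if for every $a\in G$ there is a positive integer $k$ with $ku-a\in G^{+}$. A dimension group is simple if it has no order ideals other than $\{0\}$ and $G$; equivalently, every non-zero positive element is an order unit. A state with respect to an order unit $u$ is a group homomorphism $\tau:G\to\mathbb{R}$ with $\tau(G^{+})\subseteq[0,\infty)$ and $\tau(u)=1$. The states form a compact convex subset of $\mathbb{R}^{G}$; a state is extremal if it is an extreme point of this set. *)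

(* Defs.v *)
From HB Require Import structures.
From mathcomp Require Import all_boot all_order all_algebra.
From mathcomp Require Import all_classical all_reals all_analysis.

Set Implicit Arguments.
Unset Strict Implicit.
Unset Printing Implicit Defensive.

Import Order.TTheory GRing.Theory Num.Theory.

Local Open Scope classical_set_scope.
Local Open Scope ring_scope.

(* An ordered abelian group is a [zmodType] [G] together with a cone
   [Gp : set G]; [Gp x] reads "x is positive". *)
Record ordered_abelian_group (G : zmodType) (Gp : set G) : Prop := {
  oag_countable : countable [set: G];
  oag_add : forall x y : G, Gp x -> Gp y -> Gp (x + y);
  oag_generating : forall x : G, exists y z : G, [/\ Gp y, Gp z & x = y - z];
  oag_zero : Gp 0;
  oag_antisym : forall x : G, Gp x -> Gp (- x) -> x = 0 }.

Definition simplicial_cone (m : nat) : set 'cV[int]_m :=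
  [set x | forall i, 0 <= x i ord0].

(* The group [G] is characterised by the universal property of the colimit in
   abelian groups, the cone [Gp] as the union of the images of the cones. *)
Record inductive_limit (I : nat -> nat) (A : forall n, 'M[int]_(I n.+1, I n))
    (G : zmodType) (Gp : set G)
    (eta : forall n, {additive 'cV[int]_(I n) -> G}) : Prop := {
  indlim_compat : forall n (x : 'cV[int]_(I n)), eta n.+1 (A n *m x) = eta n x;
  indlim_universal :
    forall (H : zmodType) (f : forall n, {additive 'cV[int]_(I n) -> H}),
      (forall n (x : 'cV[int]_(I n)), f n.+1 (A n *m x) = f n x) ->
      exists g : {additive G -> H},
        (forall n (x : 'cV[int]_(I n)), g (eta n x) = f n x) /\
        (forall g' : {additive G -> H},
           (forall n (x : 'cV[int]_(I n)), g' (eta n x) = f n x) -> g' =1 g);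
  indlim_cone : Gp = \bigcup_n (eta n @` @simplicial_cone (I n)) }.

Definition dimension_group (G : zmodType) (Gp : set G) : Prop :=
  ordered_abelian_group Gp /\
  exists (I : nat -> nat) (A : forall n, 'M[int]_(I n.+1, I n))
         (eta : forall n, {additive 'cV[int]_(I n) -> G}),
    (forall n i j, 0 <= A n i j) /\ inductive_limit A Gp eta.

(* Directed, order-convex subgroups. *)
Record order_ideal (G : zmodType) (Gp H : set G) : Prop := {
  ideal_zero : H 0;
  ideal_sub : forall x y : G, H x -> H y -> H (x - y);
  ideal_convex : forall x y : G, Gp x -> Gp (y - x) -> H y -> H x;
  ideal_directed : forall x : G, H x ->
    exists y z : G, [/\ H y /\ Gp y, H z /\ Gp z & x = y - z] }.

Definition simple_dimension_group (G : zmodType) (Gp : set G) : Prop :=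
  dimension_group Gp /\
  forall H : set G, order_ideal Gp H -> H = [set 0] \/ H = [set: G].

Definition order_unit (G : zmodType) (Gp : set G) (u : G) : Prop :=
  Gp u /\ forall a : G, exists k : nat, (0 < k)%N /\ Gp (u *+ k - a).

Definition states (R : realType) (G : zmodType) (Gp : set G) (u : G) :
    set (G -> R) :=
  [set tau | [/\ zmod_morphism tau,
                 forall x, Gp x -> 0 <= tau x &
                 tau u = 1]].

Definition extreme_points (R : realType) (E : lmodType R) (S : set E) : set E :=
  [set x | S x /\
    forall (y z : E) (t : R), S y -> S z -> 0 < t < 1 ->
      x = t *: y + (1 - t) *: z -> y = x /\ z = x].

Definition extremal_states (R : realType) (G : zmodType) (Gp : set G) (u : G) :
    set (G -> R) :=
  extreme_points (states Gp u).

(* Main.v *)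
Require Import Defs.
From HB Require Import structures.
From mathcomp Require Import all_boot all_order all_algebra.
From mathcomp Require Import all_classical all_reals all_analysis.
From mathcomp Require Import ring lra zify.

(* Let [g_m] be the image at stage [m] of a positive element [g].  Hypothesis 5
   makes the rows of each block row of the connecting matrix nearly equal, so
   [g_m] is nearly constant on each of the two blocks, and so are [u^1] and [u^2],
   which by hypothesis 4 are close to [K_m (1, 0)] and [K_m (0, 1)].  Hence every
   positive functional [F] defined at stage [m] satisfies
     [F g = F u^1 * phi_m g + F u^2 * psi_m g + o(1) * F (u^1 + u^2)],
   where [phi_m g], [psi_m g] are entries of [g_m] in the first and second block,
   divided by [K_m].  Applying this to [F = phi_k] and [F = psi_k], [k > m], whose
   values on [(u^1, u^2)] tend to [(1, 0)] and [(0, 1)], shows that [phi_m g] and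
   [psi_m g] are Cauchy (although the errors need not be summable); the limits are
   the states [s1] and [s2].  Applying it to a state [F] gives
   [F = F u^1 * s1 + F u^2 * s2], with nonnegative coefficients because [l_m]
   tends to infinity. *)

Set Implicit Arguments.
Unset Strict Implicit.
Unset Printing Implicit Defensive.

Import Order.TTheory GRing.Theory Num.Theory.
Import numFieldNormedType.Exports.

Local Open Scope classical_set_scope.
Local Open Scope ring_scope.

(** * Inductive limits of simplicial groups *)

Section Subgroup.
Variables (G : zmodType) (S : pred G) (S_closed : zmod_closed S).

(** The closure proof is a parameter of the type, so that the group structure can be inferred from
    the type alone. *)
Definition subgroup of zmod_closed S := {x : G | S x}.
Local Notation sG := (subgroup S_closed).
HB.instance Definition _ := [isSub of sG for @proj1_sig G S].
HB.instance Definition _ := [Choice of sG by <:].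
HB.instance Definition _ := GRing.SubChoice_isSubZmodule.Build G S sG S_closed.

End Subgroup.

Lemma conform0_zmod_morphism (m n : nat) :
  zmod_morphism (fun v : 'cV[int]_n => conform_mx (0 : 'cV_m) v).
Proof.
move=> x y; have [nm|nm] := eqVneq n m.
  by subst m; rewrite !conform_mx_id.
by rewrite !nonconform_mx ?nm // subrr.
Qed.

Lemma conform0_ge0 (m n : nat) (v : 'cV[int]_n) :
  simplicial_cone v -> simplicial_cone (conform_mx (0 : 'cV_m) v).
Proof.
move=> v0; have [nm|nm] := eqVneq n m; first by subst m; rewrite conform_mx_id.
by move=> i; rewrite nonconform_mx ?nm // mxE.
Qed.

Lemma cV_dominated m (w v : 'cV[int]_m) : (forall i, 0 < w i ord0) ->
  exists k, (0 < k)%N /\ simplicial_cone (w *+ k - v).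
Proof.
move=> w_gt0; exists (\max_i `|v i ord0|%N).+1; split=> // i.
have := w_gt0 i; have := leq_bigmax (F := fun j => `|v j ord0|%N) i => /=.
rewrite mxE mulmxnE mxE -mulr_natr natz.
move: (\max_j _)%N (w _ _) (v _ _) => k p z; nia.
Qed.

Lemma cV_pos_neg m (v : 'cV[int]_m) : exists a b : 'cV[int]_m,
  [/\ simplicial_cone a, simplicial_cone b & v = a - b].
Proof.
exists (map_mx (fun z => Num.max z 0) v), (map_mx (fun z => Num.max (- z) 0) v).
split=> [i|i|]; rewrite ?mxE ?le_max ?lexx ?orbT //.
apply/matrixP => i j; rewrite !mxE; case: (leP 0 (v i j)) => [vij|/ltW vij].
  by rewrite max_r ?oppr_le0 // subr0.
by rewrite max_l ?oppr_ge0 // sub0r opprK.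
Qed.

Section Push.
Variables (I : nat -> nat) (A : forall n, 'M[int]_(I n.+1, I n)).

(* [push v m] is the image of [v] at stage [m >= n].  Deciding [n <= m] inside
   the definition avoids transports along equalities of dimensions; for [m < n]
   the value is junk ([0], or [v] itself if the dimensions agree), but still
   additive and positive in [v]. *)
Fixpoint push n (v : 'cV[int]_(I n)) m : 'cV[int]_(I m) :=
  if m is k.+1 then
    if (n <= k)%N then A k *m push v k else conform_mx 0 v
  else conform_mx 0 v.

Lemma pushnn n (v : 'cV[int]_(I n)) : push v n = v.
Proof. by case: n v => [|n] v /=; rewrite ?ltnn conform_mx_id. Qed.

Lemma pushS n m (v : 'cV[int]_(I n)) :
  (n <= m)%N -> push v m.+1 = A m *m push v m.
Proof. by move=> /= ->. Qed.

Lemma push_mul n m (v : 'cV[int]_(I n)) :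
  (n < m)%N -> push (A n *m v) m = push v m.
Proof.
elim: m => // m IHm; rewrite ltnS leq_eqVlt => /predU1P[<-|ltnm].
  by rewrite pushnn pushS // pushnn.
by rewrite !pushS ?IHm // ltnW.
Qed.

Lemma push_push n m k (v : 'cV[int]_(I n)) :
  (n <= m)%N -> (m <= k)%N -> push (push v m) k = push v k.
Proof.
move=> lenm; elim: k => [|k IHk].
  by rewrite leqn0 => /eqP m0; subst m; rewrite pushnn.
rewrite leq_eqVlt => /predU1P[<-|lemk]; first by rewrite pushnn.
by rewrite !pushS ?IHk // (leq_trans lenm).
Qed.

Lemma push_orbit (U : forall n, 'cV[int]_(I n)) :
  (forall n, A n *m U n = U n.+1) ->
  forall n m, (n <= m)%N -> push (U n) m = U m.
Proof.
move=> AU n; elim=> [|m IHm].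
  by rewrite leqn0 => /eqP n0; subst n; rewrite pushnn.
rewrite leq_eqVlt => /predU1P[<-|lenm]; first by rewrite pushnn.
by rewrite pushS // IHm // AU.
Qed.

Lemma push_zmod_morphism n m :
  zmod_morphism (fun v : 'cV[int]_(I n) => push v m).
Proof.
elim: m => [|m IHm] x y; first exact: conform0_zmod_morphism.
rewrite /=; case: ifP => _; last exact: conform0_zmod_morphism.
by rewrite IHm mulmxBr.
Qed.

Definition push_additive n m : {additive 'cV[int]_(I n) -> 'cV[int]_(I m)} :=
  HB.pack (fun v : 'cV[int]_(I n) => push v m)
    (GRing.isZmodMorphism.Build _ _ _ (@push_zmod_morphism n m)).

Lemma pushB n m (x y : 'cV[int]_(I n)) : push (x - y) m = push x m - push y m.
Proof. exact: (raddfB (push_additive n m)). Qed.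

Lemma pushD n m (x y : 'cV[int]_(I n)) : push (x + y) m = push x m + push y m.
Proof. exact: (raddfD (push_additive n m)). Qed.

Lemma pushMn n m (x : 'cV[int]_(I n)) k : push (x *+ k) m = push x m *+ k.
Proof. exact: (raddfMn (push_additive n m)). Qed.

Hypothesis A_ge0 : forall n i j, 0 <= A n i j.

Lemma push_ge0 n m (v : 'cV[int]_(I n)) :
  simplicial_cone v -> simplicial_cone (push v m).
Proof.
move=> v0; elim: m => [|m IHm]; first exact: conform0_ge0.
rewrite /=; case: ifP => _ i; last exact: conform0_ge0.
by rewrite mxE; apply: sumr_ge0 => j _; rewrite mulr_ge0 //; exact: IHm.
Qed.

End Push.

Section InductiveLimit.
Variables (I : nat -> nat) (A : forall n, 'M[int]_(I n.+1, I n)).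
Variables (G : zmodType) (Gp : set G).
Variable eta : forall n, {additive 'cV[int]_(I n) -> G}.
Hypothesis limG : inductive_limit A Gp eta.

Lemma eta_push n m (v : 'cV[int]_(I n)) :
  (n <= m)%N -> eta m (push A v m) = eta n v.
Proof.
elim: m => [|m IHm].
  by rewrite leqn0 => /eqP n0; subst n; rewrite pushnn.
rewrite leq_eqVlt => /predU1P[<-|lenm]; first by rewrite pushnn.
by rewrite pushS // (indlim_compat limG) IHm.
Qed.

Lemma indlim_hom (H : zmodType) (f : forall n, 'cV[int]_(I n) -> H) :
  (forall n, zmod_morphism (f n)) -> (forall n x, f n.+1 (A n *m x) = f n x) ->
  exists g : {additive G -> H}, forall n x, g (eta n x) = f n x.
Proof.
move=> f_add f_compat.
pose F n : {additive 'cV[int]_(I n) -> H} :=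
  HB.pack (f n) (GRing.isZmodMorphism.Build _ _ (f n) (f_add n)).
by have [g [gE _]] := indlim_universal limG (f := F) f_compat; exists g.
Qed.

Lemma indlim_ext (H : zmodType) (g g' : {additive G -> H}) :
  (forall n x, g (eta n x) = g' (eta n x)) -> g =1 g'.
Proof.
move=> gg'; pose f n : {additive 'cV[int]_(I n) -> H} := g \o eta n.
have f_compat n x : f n.+1 (A n *m x) = f n x.
  by rewrite /f /= (indlim_compat limG).
have [h [_ h_uniq]] := indlim_universal limG f_compat => x.
by rewrite (h_uniq g) // (h_uniq g') // => n y; rewrite -gg'.
Qed.

(** The union [S] of the images of the [eta n] is a subgroup. The universal property gives a map
    from [G] to [S]; followed by the inclusion it fixes every [eta n v], so by uniqueness it is the
    identity. *)
Lemma indlim_surj x : exists n v, x = eta n v.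
Proof.
pose S := [pred y : G | `[< exists n v, y = eta n v >]].
have S_closed : zmod_closed S.
  split=> [|y z]; first by apply/asboolP; exists 0%N, 0; rewrite raddf0.
  move=> /asboolP[n [v ->]] /asboolP[m [w ->]]; apply/asboolP.
  exists (maxn n m), (push A v (maxn n m) - push A w (maxn n m)).
  by rewrite raddfB !eta_push // ?leq_maxl ?leq_maxr.
have S_eta n v : S (eta n v) by apply/asboolP; exists n, v.
pose f n (v : 'cV[int]_(I n)) : subgroup S_closed := Sub (eta n v) (S_eta n v).
have [|n v|g gE] := @indlim_hom (subgroup S_closed) f.
- by move=> n v w; apply/val_inj; rewrite raddfB !SubK raddfB.
- by apply/val_inj; rewrite !SubK (indlim_compat limG).
have vgK : (val : subgroup S_closed -> G) \o g =1 idfun.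
  by apply: indlim_ext => n v /=; rewrite gE SubK.
by have /asboolP := valP (g x); rewrite [val _]vgK.
Qed.

Lemma indlim_stage x n : exists m v, (n <= m)%N /\ x = eta m v.
Proof.
have [m [v ->]] := indlim_surj x.
exists (maxn n m), (push A v (maxn n m)); rewrite leq_maxl; split=> //.
by rewrite eta_push // leq_maxr.
Qed.

Lemma indlim_posP x :
  Gp x <-> exists n v, simplicial_cone v /\ x = eta n v.
Proof.
rewrite (indlim_cone limG); split => [[n _ [v v0 <-]]|[n [v [v0 ->]]]].
  by exists n, v.
by exists n => //; exists v.
Qed.

Lemma eta_pos n v : simplicial_cone v -> Gp (eta n v).
Proof. by move=> v0; apply/indlim_posP; exists n, v. Qed.

Lemma indlim_countable : countable [set: G].
Proof.
have -> : [set: G] = \bigcup_n range (eta n).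
  apply/seteqP; split=> // x _; have [n [v ->]] := indlim_surj x.
  by exists n => //; exists v.
apply: bigcup_countable => // n _; apply: sub_countable (card_image_le _ _) _.
exact: countableP.
Qed.

Lemma indlim_generating x : exists y z, [/\ Gp y, Gp z & x = y - z].
Proof.
have [n [v ->]] := indlim_surj x; have [a [b [a0 b0 ->]]] := cV_pos_neg v.
by exists (eta n a), (eta n b); rewrite raddfB; split=> //; exact: eta_pos.
Qed.

Hypothesis A_ge0 : forall n i j, 0 <= A n i j.

Lemma indlim_posD x y : Gp x -> Gp y -> Gp (x + y).
Proof.
move=> /indlim_posP[n [v [v0 ->]]] /indlim_posP[m [w [w0 ->]]].
pose k := maxn n m; rewrite -(eta_push v (leq_maxl n m)).
rewrite -(eta_push w (leq_maxr n m)) -raddfD; apply: eta_pos => i.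
by rewrite mxE addr_ge0 //; exact: push_ge0.
Qed.

Lemma indlim_pos0 : Gp 0.
Proof. by rewrite -(raddf0 (eta 0%N)); apply: eta_pos => i; rewrite mxE. Qed.

(** Any element of [G] is represented at some stage [m >= n], where the entries of [push A v m] are
    positive and a multiple of them dominates it. *)
Lemma pos_entries_order_unit n (v : 'cV[int]_(I n)) :
  (forall m, (n <= m)%N -> forall i, 0 < push A v m i ord0) ->
  order_unit Gp (eta n v).
Proof.
move=> v_gt0; split=> [|x].
  by apply: eta_pos => i; rewrite ltW // -[v](pushnn A) v_gt0.
have [m [w [lenm ->]]] := indlim_stage x n.
have [k [k_gt0 kvw]] := cV_dominated w (v_gt0 m lenm).
exists k; split=> //; rewrite -(eta_push v lenm) -raddfMn -raddfB.
exact: eta_pos.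
Qed.

(** * Simplicity when the connecting matrices are strictly positive *)

Section StrictlyPositive.
Hypothesis I_gt0 : forall n, (0 < I n)%N.
Hypothesis A_gt0 : forall n i j, 0 < A n i j.

(** One strictly positive matrix spreads a single positive entry to all entries. As no stage is
    empty, there is again a positive entry to start the next step from. *)
Lemma push_gt0 n m (v : 'cV[int]_(I n)) :
  simplicial_cone v -> v != 0 -> (n < m)%N -> forall i, 0 < push A v m i ord0.
Proof.
move=> v0 vN0; elim: m => // m IHm; rewrite ltnS leq_eqVlt.
have sum_gt0 (w : 'cV[int]_(I m)) j i : simplicial_cone w -> 0 < w j ord0 ->
    0 < (A m *m w) i ord0.
  move=> w0 wj; rewrite mxE (bigD1 j) //= ltr_pwDl ?mulr_gt0 //.
  by apply: sumr_ge0 => k _; rewrite mulr_ge0 // w0.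
case/predU1P=> [nm|ltnm] i.
  subst m; rewrite pushS // pushnn.
  have /cV0Pn[j vj] : v != 0 by [].
  by apply: (sum_gt0 _ j); rewrite // lt_neqAle eq_sym vj v0.
rewrite pushS ?(ltnW ltnm) //; apply: (sum_gt0 _ (Ordinal (I_gt0 m))).
  by move=> k; rewrite ltW // IHm.
exact: IHm.
Qed.

Lemma pos_order_unit x : Gp x -> x != 0 -> order_unit Gp x.
Proof.
move=> /indlim_posP[n [v [v0 ->]]] vN0.
(* The representative is moved to stage [n.+1]: at stage [n] some entries may still vanish. *)
rewrite -(eta_push v (leqnSn n)); apply: pos_entries_order_unit => m ltnm i.
rewrite push_push //; apply: push_gt0 => //.
by apply: contra vN0 => /eqP ->; rewrite raddf0.
Qed.

(** By directedness a nonzero ideal contains a nonzero positive element. This is an order unit, so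
    convexity puts every positive element, hence every difference of two, in the ideal. *)
Lemma order_ideal_trivial (H : set G) :
  order_ideal Gp H -> H = [set 0] \/ H = [set: G].
Proof.
move=> [H0 Hsub Hconv Hdir].
have HMn x k : H x -> H (x *+ k).
  move=> Hx; elim: k => // k IHk; rewrite mulrSr -[x in _ + x]opprK.
  by apply: (Hsub) => //; rewrite -sub0r; exact: Hsub.
have unitH w x : H w -> Gp w -> w != 0 -> H x.
  move=> Hw w0 wN0; have [_ wunit] := pos_order_unit w0 wN0.
  have [y [z [y0 z0 ->]]] := indlim_generating x.
  have [k [_ ky]] := wunit y; have [l [_ lz]] := wunit z.
  by apply: Hsub; [apply: (Hconv _ (w *+ k))|apply: (Hconv _ (w *+ l))];
    rewrite //; exact: HMn.
have [[x [Hx xN0]]|Hnil] := pselect (exists x, H x /\ x != 0); last first.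
  left; apply/seteqP; split=> x /= => [Hx|->//].
  by apply/eqP/negPn/negP => xN0; apply: Hnil; exists x.
right; apply/seteqP; split=> // t _.
have [y [z [[Hy y0] [Hz z0] xE]]] := Hdir x Hx.
have [y_eq0|yN0] := eqVneq y 0; last exact: (unitH y).
apply: (unitH z) => //; apply: contra xN0 => /eqP z_eq0.
by rewrite xE y_eq0 z_eq0 subrr.
Qed.

(* A state is positive on every order unit, so it separates [x] from [- x];
   this makes the cone pointed without describing the kernels of the [eta n]. *)
Lemma simple_indlim (R : realType) u (tau : G -> R) :
  states Gp u tau -> simple_dimension_group Gp.
Proof.
move=> [tau_add tau_ge0 tau_u]; pose F : {additive G -> R} :=
  HB.pack tau (GRing.isZmodMorphism.Build _ _ tau tau_add).
split; last exact: order_ideal_trivial.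
split; last by exists I, A, eta.
split; [exact: indlim_countable|exact: indlim_posD|exact: indlim_generating|
  exact: indlim_pos0|].
move=> x x0 Nx0; apply/eqP/negPn/negP => xN0.
have [_ /(_ u)[k [k_gt0 ku]]] := pos_order_unit x0 xN0.
have : 0 <= F (x *+ k - u) by exact: tau_ge0.
have : 0 <= F (- x) by exact: tau_ge0.
rewrite raddfB raddfMn raddfN /= tau_u oppr_ge0 => Fx.
by rewrite subr_ge0 leNgt (le_lt_trans (mulrn_wle0 _ Fx)).
Qed.

End StrictlyPositive.
End InductiveLimit.

(** * Estimates for positive functionals *)

(** Evaluation at [w] is an affine coordinate on [S], with values in [[0, 1]], equal to [1] at [s1]
    and [0] at [s2]; it determines each point of [S]. *)
Lemma extreme_points_segment (R : realType) (T : Type) (S : set (T -> R))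
    (s1 s2 : T -> R) (w : T) : S s1 -> S s2 -> s1 w = 1 -> s2 w = 0 ->
  (forall s, S s -> 0 <= s w <= 1 /\ s = s w *: s1 + (1 - s w) *: s2) ->
  extreme_points S = [set s1; s2].
Proof.
move=> S1 S2 s1w s2w segS; apply/seteqP; split=> s /=.
  case=> Ss extr; have [/andP[sw0 sw1] sE] := segS s Ss.
  move: sw0; rewrite le_eqVlt => /predU1P[sw0|sw0].
    by right; rewrite sE -sw0 scale0r add0r subr0 scale1r.
  move: sw1; rewrite le_eqVlt => /predU1P[sw1|sw1].
    by left; rewrite sE sw1 subrr scale0r addr0 scale1r.
  (* With [0 < s w < 1] the decomposition is a proper convex combination, so extremality would give
     [s1 = s = s2], which evaluation at [w] refutes. *)
  have [|e1 e2] := extr _ _ _ S1 S2 _ sE; first by rewrite sw0.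
  by have /eqP := oner_neq0 R; rewrite -s1w -s2w e1 e2.
have scaleE (y z : T -> R) t :
    (t *: y + (1 - t) *: z) w = t * y w + (1 - t) * z w by [].
case=> ->; split=> // y z t Sy Sz /andP[t0 t1] E.
- have [/andP[_ yw] yE] := segS y Sy; have [/andP[_ zw] zE] := segS z Sz.
  have := congr1 (@^~ w) E; rewrite /= scaleE s1w => E1.
  have y1 : y w = 1 by nra.
  have z1 : z w = 1 by nra.
  by rewrite yE zE y1 z1 subrr scale0r addr0 scale1r.
- have [/andP[yw _] yE] := segS y Sy; have [/andP[zw _] zE] := segS z Sz.
  have := congr1 (@^~ w) E; rewrite /= scaleE s2w => E0.
  have y0 : y w = 0 by nra.
  have z0 : z w = 0 by nra.
  by rewrite yE zE y0 z0 scale0r add0r subr0 scale1r.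
Qed.

(** A positive functional is a sum of coordinates with nonnegative weights; [X] and [Y] are the
    total weights of the two blocks. *)
Lemma pos_functional_near (R : realFieldType) p (F : 'cV[int]_(p + p) -> R) :
  zmod_morphism F -> (forall v, simplicial_cone v -> 0 <= F v) ->
  exists X Y, [/\ 0 <= X, 0 <= Y & forall (v : 'cV_(p + p)) a b e,
    (forall j, `|(v (lshift p j) ord0)%:~R - a| <= e) ->
    (forall j, `|(v (rshift p j) ord0)%:~R - b| <= e) ->
    `|F v - (a * X + b * Y)| <= e * (X + Y)].
Proof.
move=> F_add F_ge0; pose w i := F (delta_mx i ord0).
have w_ge0 i : 0 <= w i.
  by apply: F_ge0 => j; rewrite mxE; case: (_ && _).
have FE v : F v = \sum_i (v i ord0)%:~R * w i.
  pose H : {additive 'cV[int]_(p + p) -> R} :=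
    HB.pack F (GRing.isZmodMorphism.Build _ _ F F_add).
  have -> : F v = H v by [].
  rewrite [in LHS](matrix_sum_delta v) raddf_sum; apply: eq_bigr => i _.
  rewrite big_ord1 -[v i 0]intz scaler_int raddfMz mulrzl.
  by rewrite intz.
exists (\sum_j w (lshift p j)), (\sum_j w (rshift p j)).
split=> [||v a b e va vb]; [exact: sumr_ge0|exact: sumr_ge0|].
rewrite FE big_split_ord /= mulrDr !mulr_sumr opprD addrACA -!sumrB.
apply: le_trans (ler_normD _ _) _; apply: lerD;
  apply: le_trans (ler_norm_sum _ _ _) _; apply: ler_sum => j _;
  rewrite -mulrBl normrM [`|w _|]ger0_norm //;
  exact: ler_wpM2r.
Qed.

(* The mass [K * (X + Y)] of the functional is controlled by its value on
   [u1 + u2], so that errors relative to that mass are errors relative to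
   [F u1 + F u2]. *)
Lemma two_block_estimate (R : realFieldType) p (F : 'cV[int]_(p + p) -> R)
    (u1 u2 g : 'cV[int]_(p + p)) (K c d e a b : R) :
  zmod_morphism F -> (forall v, simplicial_cone v -> 0 <= F v) ->
  0 < K -> 0 <= e <= 4^-1 -> 0 <= d -> 0 <= a <= c * K -> 0 <= b <= c * K ->
  (forall j, `|(u1 (lshift p j) ord0)%:~R - K| <= e * K) ->
  (forall j, `|(u1 (rshift p j) ord0)%:~R - 0| <= e * K) ->
  (forall j, `|(u2 (lshift p j) ord0)%:~R - 0| <= e * K) ->
  (forall j, `|(u2 (rshift p j) ord0)%:~R - K| <= e * K) ->
  (forall j, `|(g (lshift p j) ord0)%:~R - a| <= d * a) ->
  (forall j, `|(g (rshift p j) ord0)%:~R - b| <= d * b) ->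
  [/\ - (2 * e * (F u1 + F u2)) <= F u1, - (2 * e * (F u1 + F u2)) <= F u2 &
  `|F g - (F u1 * (a / K) + F u2 * (b / K))|
    <= 2 * c * (d + 2 * e) * (F u1 + F u2)].
Proof.
move=> F_add F_ge0 K0 /andP[e0 e14] d0 /andP[a0 ac] /andP[b0 bc].
move=> u1l u1r u2l u2r gl gr.
have [X [Y [X0 Y0 Fnear]]] := pos_functional_near F_add F_ge0.
have E1 := Fnear _ _ _ _ u1l u1r; have E2 := Fnear _ _ _ _ u2l u2r.
have dcK x : 0 <= x <= c * K -> d * x <= d * (c * K).
  by case/andP=> _ xc; rewrite ler_wpM2l.
have Eg : `|F g - (a * X + b * Y)| <= d * (c * K) * (X + Y).
  by apply: Fnear => j; [apply: le_trans (gl j) _|apply: le_trans (gr j) _];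
    apply: dcK; rewrite ?a0 ?b0.
move: (F u1) (F u2) (F g) E1 E2 Eg => f1 f2 fg.
rewrite mul0r addr0 mul0r add0r => E1 E2 Eg.
pose A := a / K; pose B := b / K; pose S := K * (X + Y).
have K_ge0 := ltW K0.
have aE : a = A * K by rewrite /A divfK // gt_eqF.
have bE : b = B * K by rewrite /B divfK // gt_eqF.
have A0 : 0 <= A by rewrite divr_ge0.
have B0 : 0 <= B by rewrite divr_ge0.
have Ac : A <= c by rewrite ler_pdivrMr.
have Bc : B <= c by rewrite ler_pdivrMr.
have S0 : 0 <= S by rewrite mulr_ge0 // addr_ge0.
have {}E1 : `|f1 - K * X| <= e * S by rewrite /S mulrA.
have {}E2 : `|f2 - K * Y| <= e * S by rewrite /S mulrA.
have {}Eg : `|fg - (A * (K * X) + B * (K * Y))| <= d * (c * S).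
  by rewrite !mulrA -aE -bE /S; move: Eg; rewrite !mulrA.
have KX0 : 0 <= K * X by rewrite mulr_ge0.
have KY0 : 0 <= K * Y by rewrite mulr_ge0.
have SE : S = K * X + K * Y by rewrite /S mulrDr.
(* The two estimates add up to [f1 + f2 >= S - 2 * (e * S)], and [e <= 4^-1] makes the right side at
   least half of [S]. *)
have Sf : S <= 2 * (f1 + f2).
  move: E1 E2; rewrite !ler_distl => /andP[E1 _] /andP[E2 _].
  have : e * S <= 4^-1 * S by rewrite ler_wpM2r.
  lra.
have c0 : 0 <= c by exact: le_trans A0 Ac.
have eS : e * S <= 2 * e * (f1 + f2) by rewrite [2 * e]mulrC -mulrA ler_wpM2l.
split.
- by move: E1; rewrite ler_distl => /andP[E1 _]; lra.
- by move: E2; rewrite ler_distl => /andP[E2 _]; lra.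
(* Replacing [K * X] by [f1] and [K * Y] by [f2] costs at most [c * (e * S)] each, on top of the
   error [d * (c * S)] for [g]. *)
have -> : fg - (f1 * A + f2 * B) = fg - (A * (K * X) + B * (K * Y))
    - A * (f1 - K * X) - B * (f2 - K * Y) by ring.
apply: le_trans (ler_normB _ _) _; rewrite normrM (ger0_norm B0).
have E3 : B * `|f2 - K * Y| <= c * (e * S) by rewrite ler_pM.
have E4 : A * `|f1 - K * X| <= c * (e * S) by rewrite ler_pM.
have E5 := ler_normB (fg - (A * (K * X) + B * (K * Y))) (A * (f1 - K * X)).
move: E5; rewrite [in X in _ <= X]normrM (ger0_norm A0) => E5.
have : c * (d * S) <= c * (d * (2 * (f1 + f2))) by rewrite !ler_wpM2l.
have : c * (e * S) <= c * (2 * e * (f1 + f2)) by rewrite ler_wpM2l.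
lra.
Qed.

(** * Convergence from errors that tend to zero *)

Lemma cvgn_of_approx (R : realType) (x d : R^nat) (C t : R) N :
  d n @[n --> \oo] --> 0 ->
  (forall m, (N <= m)%N -> `|t - x m.+1| <= C * d m) ->
  x n @[n --> \oo] --> t.
Proof.
move=> d0 xt; rewrite -(cvg_shiftS x); apply/cvgrPdist_le => eps eps0.
have Cd0 : C * d n @[n --> \oo] --> 0.
  by rewrite -[0 in X in _ --> X](mulr0 C); apply: cvgM => //; exact: cvg_cst.
near=> m; apply: (@le_trans _ _ (C * d m)).
  by apply: xt; near: m; exact: nbhs_infty_ge.
by near: m; exact: cvgr_le Cd0 _ eps0.
Unshelve. all: by end_near. Qed.

(** The bound is uniform in [k]: the whole tail after [m] stays in one small ball around [x m.+1],
    so the sequence is Cauchy even if [d] is not summable. *)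
Lemma is_cvgn_of_approx (R : realType) (x d : R^nat) (C : R) N :
  d n @[n --> \oo] --> 0 ->
  (forall m k, (N <= m)%N -> (m < k)%N -> `|x k - x m.+1| <= C * d m) ->
  cvgn x.
Proof.
move=> d0 xC; apply/cauchy_cvgP/cauchy_exP => eps eps0.
have Cd0 : C * d n @[n --> \oo] --> 0.
  by rewrite -[0 in X in _ --> X](mulr0 C); apply: cvgM => //; exact: cvg_cst.
have [M _ dM] := cvgr_lt _ Cd0 _ eps0.
pose m := maxn N M; exists (x m.+1); exists m.+1 => // k /= mk.
rewrite /ball /= distrC; apply: le_lt_trans (xC _ _ _ mk) _.
  exact: leq_maxl.
by apply: dM; exact: leq_maxr.
Qed.

(** Used with [a], [b] the values of a late coordinate on [u^1], [u^2], in the order that makes them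
    close to [1], [0]. The constant is [5 = 3 + 1 + 1]: [3] from the assumed error, as
    [a + b <= 1 + 2 * e <= 3 / 2], and [1] each for replacing [a] by [1] and [b] by [0]. *)
Lemma near_vertex (R : realFieldType) (x p q a b c d e : R) :
  `|a - 1| <= e -> `|b| <= e -> e <= d -> e <= 4^-1 ->
  0 <= p <= c -> 0 <= q <= c ->
  `|x - (a * p + b * q)| <= 2 * c * d * (a + b) -> `|x - p| <= 5 * c * d.
Proof.
move=> a1 b0 ed e4 /andP[p0 pc] /andP[q0 qc] xE.
have c0 : 0 <= c by exact: le_trans pc.
have d0 : 0 <= d by apply: le_trans ed; exact: le_trans a1.
have cd0 : 0 <= 2 * c * d by rewrite !mulr_ge0.
have -> : x - p = x - (a * p + b * q) + ((a - 1) * p + b * q) by ring.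
have ab : 2 * c * d * (a + b) <= 2 * c * d * (3 / 2).
  rewrite ler_wpM2l //; move: a1 b0; rewrite ler_distl ler_norml.
  by move=> /andP[_ ?] /andP[_ ?]; lra.
have ap : `|(a - 1) * p| <= d * c.
  by rewrite normrM (ger0_norm p0) ler_pM // (le_trans a1).
have bq : `|b * q| <= d * c.
  by rewrite normrM (ger0_norm q0) ler_pM // (le_trans b0).
have := ler_normD (x - (a * p + b * q)) ((a - 1) * p + b * q).
have := ler_normD ((a - 1) * p) (b * q).
lra.
Qed.

(** * Two weakly interacting blocks *)

Section TwoBlockSystem.
Variables (R : realType) (J : nat -> nat).
Variables (u11 u12 u21 u22 : forall n, 'cV[int]_(J n)).
Variables (A11 A12 A21 A22 : forall n, 'M[int]_(J n.+1, J n)).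
Variables (G : zmodType) (Gp : set G).
Variable eta : forall n, {additive 'cV[int]_(J n + J n) -> G}.
Variables (r : nat -> R) (K l : nat -> nat).

Let B n := block_mx (A11 n) (A12 n) (A21 n) (A22 n).
Let U1 n := col_mx (u11 n) (u12 n).
Let U2 n := col_mx (u21 n) (u22 n).

Hypothesis J_gt0 : forall n, (0 < J n)%N.
Hypothesis A_gt0 : forall n i j,
  [/\ 0 < A11 n i j, 0 < A12 n i j, 0 < A21 n i j & 0 < A22 n i j].
Hypothesis BU1 : forall n, B n *m U1 n = U1 n.+1.
Hypothesis BU2 : forall n, B n *m U2 n = U2 n.+1.
Hypothesis limG : inductive_limit (I := fun n => (J n + J n)%N) B Gp eta.
Hypothesis r_decr : forall n, r n.+1 <= r n.
Hypothesis r_bound : forall n, 1 < r n < 2.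
Hypothesis r_cvg : r n @[n --> \oo] --> (1 : R).
Hypothesis l_incr : forall n, (l n < l n.+1)%N.
Hypothesis K_ge4 : forall n, (4 <= K n)%N.
Hypothesis l_ge4 : forall n, (4 <= l n)%N.
Hypothesis u_bound : forall n i,
  [/\ (r n)^-1 * (K n)%:R <= (u11 n i ord0)%:~R <= r n * (K n)%:R,
      (r n)^-1 * (K n)%:R <= (u22 n i ord0)%:~R <= r n * (K n)%:R,
      - (r n * (K n)%:R) <= (l n)%:R * (u12 n i ord0)%:~R
                         <= - ((r n)^-1 * (K n)%:R) &
      - (r n * (K n)%:R) <= (l n)%:R * (u21 n i ord0)%:~R
                         <= - ((r n)^-1 * (K n)%:R)].
Hypothesis A_bound : forall n (j' j'' : 'I_(J n.+1)) (j : 'I_(J n)),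
  (r n)^-1 * (A11 n j' j)%:~R <= (l n)%:R * (A21 n j'' j)%:~R
                              <= r n * (A11 n j' j)%:~R /\
  (r n)^-1 * (A22 n j' j)%:~R <= (l n)%:R * (A12 n j'' j)%:~R
                              <= r n * (A22 n j' j)%:~R.

(* [e n] bounds the relative deviation of [U1 n], [U2 n] from [K n] times the
   indicators of the two blocks, [d n] that of the whole step from [n] to
   [n.+1]; both tend to [0], and no summability is available. *)
Let e n := (r n - 1) + 2 / (l n)%:R.
Let d n := r n ^+ 2 - 1 + 2 * e n.+1.

Let K_gt0 n : 0 < (K n)%:R :> R.
Proof. by rewrite ltr0n (leq_trans _ (K_ge4 n)). Qed.

Let l_gt0 n : 0 < (l n)%:R :> R.
Proof. by rewrite ltr0n (leq_trans _ (l_ge4 n)). Qed.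

Let r_gt0 n : 0 < r n.
Proof. by have /andP[/(lt_trans ltr01)] := r_bound n. Qed.

Let e_ge0 n : 0 <= e n.
Proof.
have /andP[r1 _] := r_bound n.
by rewrite addr_ge0 ?divr_ge0 ?ltW // subr_gt0.
Qed.

Let e_decr n : e n.+1 <= e n.
Proof.
rewrite lerD ?lerB // ler_pM2l // lef_pV2 ?posrE //.
by rewrite ler_nat ltnW.
Qed.

Let e_le_d n : e n.+1 <= d n.
Proof.
have /andP[r1 _] := r_bound n; have := e_ge0 n.+1.
have : 1 <= r n ^+ 2 by rewrite exprn_ege1 // ltW.
rewrite /d; lra.
Qed.

Let e_cvg : e n @[n --> \oo] --> 0.
Proof.
have -> : 0 = (1 - 1) + 2 * 0 :> R by rewrite subrr mulr0 addr0.
apply: cvgD; first by apply: cvgB => //; exact: cvg_cst.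
apply: cvgM; first exact: cvg_cst.
(* Strict growth of [l] puts [(l n)^-1] below the harmonic sequence. *)
have l_gt n : (n < l n)%N.
  elim: n => [|n IHn]; first by rewrite (leq_trans _ (l_ge4 0)).
  exact: leq_ltn_trans IHn _.
apply: (squeeze_cvgr _ (cvg_cst _) (@cvg_harmonic R)); near=> n.
by rewrite /harmonic invr_ge0 ltW //= lef_pV2 ?posrE ?ltr0Sn // ler_nat l_gt.
Unshelve. all: by end_near. Qed.

Let d_cvg : d n @[n --> \oo] --> 0.
Proof.
have -> : 0 = (1 ^+ 2 - 1) + 2 * 0 :> R by rewrite expr1n subrr mulr0 addr0.
apply: cvgD.
  apply: cvgB; last exact: cvg_cst.
  by apply: (cvg_comp r (fun x => x ^+ 2)) r_cvg _; exact: exprn_continuous.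
apply: cvgM; first exact: cvg_cst.
by rewrite (cvg_shiftS e).
Qed.

(** The two summands of [e n] serve different blocks: [r n - 1] bounds the deviation of [u11], [u22]
    from [K n], and [2 / l n] bounds the size of [u12], [u21], because [r n < 2]. *)
Lemma u_near n (i : 'I_(J n)) :
  [/\ `|(u11 n i ord0)%:~R - (K n)%:R| <= e n * (K n)%:R,
      `|(u22 n i ord0)%:~R - (K n)%:R| <= e n * (K n)%:R,
      `|(u12 n i ord0)%:~R - 0| <= e n * (K n)%:R &
      `|(u21 n i ord0)%:~R - 0| <= e n * (K n)%:R].
Proof.
have [h11 h22 h12 h21] := u_bound i; have /andP[r1 r2] := r_bound n.
have := l_gt0 n; have := K_gt0 n => K0 l0.
(* This is [(r n - 1) ^+ 2 >= 0]; it makes the bounds around [K n] symmetric. *)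
have V2 : 2 - r n <= (r n)^-1.
  rewrite -(ler_pM2r (r_gt0 n)) mulVf ?gt_eqF //; nra.
have near1 x : (r n)^-1 * (K n)%:R <= x <= r n * (K n)%:R ->
    `|x - (K n)%:R| <= e n * (K n)%:R.
  case/andP=> x1 x2; apply: (@le_trans _ _ ((r n - 1) * (K n)%:R)).
    rewrite ler_distl; have : (2 - r n) * (K n)%:R <= (r n)^-1 * (K n)%:R.
      by rewrite ler_wpM2r // ltW.
    by move=> ?; apply/andP; split; lra.
  by rewrite ler_wpM2r ?(ltW K0) // lerDl divr_ge0 // ltW.
have near0 x : - (r n * (K n)%:R) <= (l n)%:R * x <= - ((r n)^-1 * (K n)%:R) ->
    `|x - 0| <= e n * (K n)%:R.
  rewrite subr0 => /andP[x1 x2].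
  have x0 : x <= 0.
    rewrite -(pmulr_rle0 _ l0) (le_trans x2) // oppr_le0 mulr_ge0 ?invr_ge0 //.
      by rewrite ltW.
  rewrite ler0_norm // (@le_trans _ _ (2 / (l n)%:R * (K n)%:R)) //; last first.
    by rewrite ler_wpM2r ?(ltW K0) // lerDr subr_ge0 ltW.
  rewrite mulrAC ler_pdivlMr // mulNr [x * _]mulrC lerNl.
  by rewrite (le_trans _ x1) // lerNl opprK ler_wpM2r // ltW.
by split; [exact: near1|exact: near1|exact: near0|exact: near0].
Qed.

Local Notation thread := (@push (fun n => (J n + J n)%N) B).

Let B_gt0 n i j : 0 < B n i j.
Proof.
rewrite /B; case: (split_ordP i) => i' ->; case: (split_ordP j) => j' ->;
  rewrite ?block_mxEul ?block_mxEur ?block_mxEdl ?block_mxEdr;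
  by case: (A_gt0 i' j').
Qed.

Let B_ge0 n i j : 0 <= B n i j. Proof. exact: ltW. Qed.

Let push_U1 n m : (n <= m)%N -> thread (U1 n) m = U1 m.
Proof. exact: (push_orbit (I := fun n => (J n + J n)%N) BU1). Qed.

Let push_U2 n m : (n <= m)%N -> thread (U2 n) m = U2 m.
Proof. exact: (push_orbit (I := fun n => (J n + J n)%N) BU2). Qed.

(** In each block one summand exceeds [K n / 2], and the other exceeds [- K n / 2] because [r n < 2]
    and [l n >= 4]. *)
Let U_gt0 n i : 0 < (U1 n + U2 n) i ord0.
Proof.
have /andP[r1 r2] := r_bound n; have := l_gt0 n; have := K_gt0 n => K0 l0.
have l4 : 4 <= (l n)%:R :> R by rewrite (ler_nat R 4) l_ge4.
have V2 : 2^-1 < (r n)^-1 by rewrite ltf_pV2 ?posrE.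
have pos x y : (r n)^-1 * (K n)%:R <= x -> - (r n * (K n)%:R) <= (l n)%:R * y ->
    0 < x + y.
  move=> xK yK; have rK : r n * (K n)%:R < 2 * (K n)%:R by rewrite ltr_pM2r.
  have : 2^-1 * (K n)%:R < (r n)^-1 * (K n)%:R by rewrite ltr_pM2r.
  nra.
rewrite mxE -(ltr0z R) rmorphD /=.
case: (split_ordP i) => j ->; rewrite ?col_mxEu ?col_mxEd;
  have [/andP[? _] /andP[? _] /andP[? _] /andP[? _]] := u_bound j.
- exact: pos.
- by rewrite addrC; exact: pos.
Qed.

(** Two entries of a diagonal block in the same column are both compared with one entry of the
    off-diagonal block below or above them, and vice versa. Each comparison costs a factor [r n],
    hence [r n ^+ 2]; nonnegativity of [v] carries this over to the rows of [B n *m v]. *)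
Lemma rows_near_constant n (v : 'cV[int]_(J n + J n)) (j' j'' : 'I_(J n.+1)) :
  simplicial_cone v ->
  `|((B n *m v) (lshift _ j') ord0)%:~R - ((B n *m v) (lshift _ j'') ord0)%:~R|
    <= (r n ^+ 2 - 1) * ((B n *m v) (lshift _ j'') ord0)%:~R :> R /\
  `|((B n *m v) (rshift _ j') ord0)%:~R - ((B n *m v) (rshift _ j'') ord0)%:~R|
    <= (r n ^+ 2 - 1) * ((B n *m v) (rshift _ j'') ord0)%:~R :> R.
Proof.
move=> v0; have r0 := r_gt0 n; have rN0 : r n != 0 by rewrite gt_eqF.
have Bv i :
    ((B n *m v) i ord0)%:~R = \sum_j (B n i j)%:~R * (v j ord0)%:~R :> R.
  by rewrite mxE rmorph_sum; apply: eq_bigr => j _; rewrite rmorphM.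
have Bv_le (i i' : 'I_(J n.+1 + J n.+1)) :
    (forall j, (B n i j)%:~R <= r n ^+ 2 * (B n i' j)%:~R :> R) ->
    ((B n *m v) i ord0)%:~R <= r n ^+ 2 * ((B n *m v) i' ord0)%:~R :> R.
  move=> Bii'; rewrite !Bv mulr_sumr; apply: ler_sum => j _.
  by rewrite mulrA ler_wpM2r // ler0z v0.
have near (x y : R) : x <= r n ^+ 2 * y ->
    y <= r n ^+ 2 * x -> 0 <= x -> 0 <= y -> `|x - y| <= (r n ^+ 2 - 1) * y.
  have : 1 <= r n ^+ 2 by rewrite exprn_ege1 // ltW //; case/andP: (r_bound n).
  by move=> rr xy yx x0 y0; rewrite ler_distl; apply/andP; split; nra.
have A_diag a c x : (r n)^-1 * a <= x <= r n * a ->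
    (r n)^-1 * c <= x <= r n * c -> a <= r n ^+ 2 * c.
  move=> /andP[ax _] /andP[_ xc]; rewrite expr2 -mulrA -ler_pdivrMl //.
  exact: le_trans xc.
have A_off x y a : (r n)^-1 * a <= (l n)%:R * x <= r n * a ->
    (r n)^-1 * a <= (l n)%:R * y <= r n * a -> x <= r n ^+ 2 * y.
  move=> /andP[_ xa] /andP[ay _]; rewrite -(ler_pM2l (l_gt0 n)).
  by rewrite (le_trans xa) // expr2 mulrCA -mulrA ler_pM2l // -ler_pdivrMl.
have B_le j1 j2 j :
    (B n (lshift _ j1) j)%:~R <= r n ^+ 2 * (B n (lshift _ j2) j)%:~R :> R /\
    (B n (rshift _ j1) j)%:~R <= r n ^+ 2 * (B n (rshift _ j2) j)%:~R :> R.
  rewrite /B; case: (split_ordP j) => k ->;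
    rewrite ?block_mxEul ?block_mxEur ?block_mxEdl ?block_mxEdr.
  - have [h1 _] := A_bound j1 j1 k; have [h2 _] := A_bound j2 j1 k.
    have [h3 _] := A_bound j1 j2 k.
    by split; [exact: A_diag h1 h2|exact: A_off h1 h3].
  - have [_ h1] := A_bound j1 j1 k; have [_ h2] := A_bound j2 j1 k.
    have [_ h3] := A_bound j1 j2 k.
    by split; [exact: A_off h1 h3|exact: A_diag h1 h2].
have v_ge0 i : 0 <= ((B n *m v) i ord0)%:~R :> R.
  by rewrite Bv sumr_ge0 // => j _; rewrite mulr_ge0 // ler0z ?v0.
split; apply: near => //; apply: Bv_le => j.
- exact: (B_le j' j'' j).1.
- exact: (B_le j'' j' j).1.
- exact: (B_le j' j'' j).2.
- exact: (B_le j'' j' j).2.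
Qed.

(** * Normalised block coordinates and their limits *)

Let lft m : 'I_(J m + J m) := lshift (J m) (Ordinal (J_gt0 m)).
Let rgt m : 'I_(J m + J m) := rshift (J m) (Ordinal (J_gt0 m)).

(** [coord lft] and [coord rgt] are the [phi] and [psi] of the overview, read off from the first
    entry of each block. *)
Let coord (c : forall m, 'I_(J m + J m)) n (v : 'cV[int]_(J n + J n)) m : R :=
  (thread v m (c m) ord0)%:~R / (K m)%:R.

Lemma coord_push c n m (v : 'cV[int]_(J n + J n)) k : (n <= m)%N ->
  (m <= k)%N -> coord c (thread v m) k = coord c v k.
Proof. by move=> nm mk; rewrite /coord push_push. Qed.

Let coord_add c n m :
  zmod_morphism (fun v : 'cV[int]_(J n + J n) => coord c v m).
Proof. by move=> v w; rewrite /coord pushB !mxE rmorphB /= mulrBl. Qed.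

Let coord_ge0 c n m (v : 'cV[int]_(J n + J n)) :
  simplicial_cone v -> 0 <= coord c v m.
Proof.
move=> v0; rewrite /coord divr_ge0 ?(ltW (K_gt0 m)) // ler0z.
exact: (push_ge0 (I := fun n => (J n + J n)%N) B_ge0).
Qed.

Let coord_lft_U m :
  `|coord lft (U1 m) m - 1| <= e m /\ `|coord lft (U2 m) m| <= e m.
Proof.
rewrite /coord !pushnn /U1 /U2 /lft !col_mxEu.
have [h1 _ _ h2] := u_near (Ordinal (J_gt0 m)); have Km := K_gt0 m.
have KN0 : (K m)%:R != 0 :> R by rewrite gt_eqF.
rewrite -[X in _ - X](divff KN0) -mulrBl !normrM normfV (gtr0_norm Km).
by rewrite subr0 in h2; rewrite !ler_pdivrMr.
Qed.

Let coord_rgt_U m :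
  `|coord rgt (U1 m) m| <= e m /\ `|coord rgt (U2 m) m - 1| <= e m.
Proof.
rewrite /coord !pushnn /U1 /U2 /rgt !col_mxEd.
have [_ h1 h2 _] := u_near (Ordinal (J_gt0 m)); have Km := K_gt0 m.
have KN0 : (K m)%:R != 0 :> R by rewrite gt_eqF.
rewrite -[X in _ - X](divff KN0) -mulrBl !normrM normfV (gtr0_norm Km).
by rewrite subr0 in h2; rewrite !ler_pdivrMr.
Qed.

(** A multiple [k] of [u^1 + u^2] dominates [v], and the coordinates of [u^1 + u^2] are at most
    [1 + 2 * e m <= 2]. *)
Let coord_bounded n (v : 'cV[int]_(J n + J n)) : exists2 c, 0 <= c &
  forall m, (n <= m)%N -> e m <= 4^-1 ->
    coord lft v m <= c /\ coord rgt v m <= c.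
Proof.
have [k [_ kUv]] := cV_dominated v (@U_gt0 n).
exists (k%:R * 2) => [|m nm em]; first by rewrite mulr_ge0.
have bnd c : coord c (U1 m) m + coord c (U2 m) m <= 2 ->
    coord c v m <= k%:R * 2.
  move=> cU; have := coord_ge0 c m kUv.
  have cE : coord c ((U1 n + U2 n) *+ k - v) m =
      k%:R * (coord c (U1 m) m + coord c (U2 m) m) - coord c v m.
    rewrite /coord pushB pushMn pushD push_U1 // push_U2 // !pushnn.
    rewrite mxE mulmxnE !mxE rmorphB /= rmorphMn /= rmorphD /= mulrBl.
    by rewrite -mulr_natl -mulrA mulrDl.
  rewrite cE subr_ge0 => /le_trans; apply.
  by rewrite ler_wpM2l.
have [h1 h2] := coord_lft_U m; have [h3 h4] := coord_rgt_U m.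
split; apply: bnd.
- by move: h1 h2; rewrite ler_distl ler_norml => /andP[_ ?] /andP[_ ?]; lra.
- by move: h3 h4; rewrite ler_distl ler_norml => /andP[_ ?] /andP[_ ?]; lra.
Qed.

(** The last step, from [m] to [m.+1], makes the thread nearly constant on blocks with relative
    error [r m ^+ 2 - 1]; adding [2 * e m.+1] gives [d m]. The functional is left general to cover
    both later coordinates and states. *)
Let estimate n (v : 'cV[int]_(J n + J n)) c m
    (F : 'cV[int]_(J m.+1 + J m.+1) -> R) (f := F (U1 m.+1) + F (U2 m.+1)) :
  zmod_morphism F -> (forall w, simplicial_cone w -> 0 <= F w) ->
  simplicial_cone v -> (n <= m)%N -> e m.+1 <= 4^-1 ->
  coord lft v m.+1 <= c -> coord rgt v m.+1 <= c ->
  [/\ - (2 * e m.+1 * f) <= F (U1 m.+1), - (2 * e m.+1 * f) <= F (U2 m.+1) &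
  `|F (thread v m.+1) - (F (U1 m.+1) * coord lft v m.+1
                          + F (U2 m.+1) * coord rgt v m.+1)|
    <= 2 * c * d m * f].
Proof.
move=> F_add F_ge0 v0 nm e4; rewrite !ler_pdivrMr // => vl vr.
have r1 : 1 <= r m ^+ 2.
  by rewrite exprn_ege1 // ltW //; case/andP: (r_bound m).
have th0 k : simplicial_cone (thread v k).
  exact: (push_ge0 (I := fun n => (J n + J n)%N) B_ge0).
have thE : thread v m.+1 = B m *m thread v m by rewrite pushS.
apply: two_block_estimate => //; rewrite ?e_ge0 ?subr_ge0 ?ler0z ?th0 // => j;
  rewrite /U1 /U2 ?col_mxEu ?col_mxEd; try by case: (u_near j).
- by rewrite thE; exact: (rows_near_constant _ _ (th0 m)).1.
- by rewrite thE; exact: (rows_near_constant _ _ (th0 m)).2.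
Qed.

Let e_small : exists N, forall m, (N <= m)%N -> e m <= 4^-1.
Proof.
have [|N _ eN] := cvgr_le _ e_cvg (4^-1 : R); first by rewrite invr_gt0.
by exists N => m; exact: eN.
Qed.

Let is_cvg_coord_ge0 n (v : 'cV[int]_(J n + J n)) : simplicial_cone v ->
  cvgn (coord lft v) /\ cvgn (coord rgt v).
Proof.
move=> v0; have [c c0 vc] := coord_bounded v; have [N eN] := e_small.
(* The functional is the coordinate at the later stage [k], pulled back to stage [m.+1]. *)
have approx i m k : (maxn n N <= m)%N -> (m < k)%N ->
    `|coord i v k - (coord i (U1 k) k * coord lft v m.+1
                     + coord i (U2 k) k * coord rgt v m.+1)|
    <= 2 * c * d m * (coord i (U1 k) k + coord i (U2 k) k).
  rewrite geq_max => /andP[nm Nm] mk.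
  have nm1 : (n <= m.+1)%N by rewrite leqW.
  have e4 : e m.+1 <= 4^-1 by rewrite eN // leqW.
  have [vl vr] := vc _ nm1 e4.
  have [_ _] := estimate (F := fun w => coord i w k) (@coord_add i m.+1 k)
    (@coord_ge0 i m.+1 k) v0 nm e4 vl vr.
  rewrite coord_push //.
  rewrite -(coord_push i (U1 m.+1) mk (leqnn k)).
  by rewrite -(coord_push i (U2 m.+1) mk (leqnn k)) push_U1 ?push_U2.
(* Since [e] decreases, [e k <= e m.+1 <= d m]: the error made at stage [k] is also bounded
   independently of [k]. *)
have small m k : (maxn n N <= m)%N -> (m < k)%N -> e k <= d m /\ e k <= 4^-1.
  rewrite geq_max => /andP[_ Nm] mk; split; last first.
    by rewrite eN // ltnW // (leq_ltn_trans Nm).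
  apply: le_trans (e_le_d m); rewrite -(subnK mk).
  by elim: (k - m.+1)%N => // j; apply: le_trans; exact: e_decr.
have bounds m : (maxn n N <= m)%N ->
    0 <= coord lft v m.+1 <= c /\ 0 <= coord rgt v m.+1 <= c.
  rewrite geq_max => /andP[nm Nm]; rewrite !coord_ge0 //=.
  by apply: vc; [rewrite leqW|rewrite eN // leqW].
split; apply: (@is_cvgn_of_approx _ _ d (5 * c) (maxn n N) d_cvg) => m k nm mk;
  have [ed e4] := small m k nm mk; have [vl vr] := bounds m nm.
- have [h1 h2] := coord_lft_U k.
  exact: near_vertex h1 h2 ed e4 vl vr (approx lft m k nm mk).
- have [h1 h2] := coord_rgt_U k.
  (* For the second block it is [u^2] whose coordinate is near [1], so the two terms change
     roles. *)
  apply: near_vertex h2 h1 ed e4 vr vl _; have := approx rgt m k nm mk.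
  by rewrite [X in _ - X]addrC [coord _ (U1 k) k + _]addrC.
Qed.

Let is_cvg_coord n (v : 'cV[int]_(J n + J n)) :
  cvgn (coord lft v) /\ cvgn (coord rgt v).
Proof.
have [a [b [a0 b0 ->]]] := cV_pos_neg v.
have coordB i : coord i (a - b) = coord i a - coord i b.
  by apply/funext => m; rewrite coord_add.
have [al ar] := is_cvg_coord_ge0 a0; have [bl br] := is_cvg_coord_ge0 b0.
by rewrite !coordB; split; apply: is_cvgB.
Qed.

Let limit_state (i : forall m, 'I_(J m + J m)) :
  (forall n (v : 'cV[int]_(J n + J n)), cvgn (coord i v)) ->
  exists2 s : {additive G -> R}, (forall x, Gp x -> 0 <= s x) &
    forall n v, coord i v m @[m --> \oo] --> s (eta n v).
Proof.
move=> i_cvg; pose f n (v : 'cV[int]_(J n + J n)) := limn (coord i v).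
have [||s sE] := @indlim_hom _ _ _ _ _ limG R f.
- move=> n v w; rewrite /f -limB //; congr (limn _).
  by apply/funext => m; rewrite coord_add.
(* The threads of [B n *m v] and [v] agree only at stages after [n]; the junk values before that do
   not affect the limit. *)
- move=> n v; apply: cvg_lim => //; apply: cvg_trans (i_cvg n v).
  apply: near_eq_cvg; near=> m; rewrite /coord push_mul //.
  by near: m; exact: nbhs_infty_gt.
exists s => [x|n v]; last by rewrite sE; exact: i_cvg.
move=> /(indlim_posP limG)[n [v [v0 ->]]]; rewrite sE.
by apply: limr_ge => //; near=> m; exact: coord_ge0.
Unshelve. all: by end_near. Qed.

(** * The limit states and the decomposition of an arbitrary state *)

Let u1 := eta 0%N (U1 0%N).
Let u2 := eta 0%N (U2 0%N).

Let eta_U1 n : eta n (U1 n) = u1.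
Proof. by rewrite -(push_U1 (leq0n n)) (eta_push limG). Qed.

Let eta_U2 n : eta n (U2 n) = u2.
Proof. by rewrite -(push_U2 (leq0n n)) (eta_push limG). Qed.

Let u_order_unit : order_unit Gp (u1 + u2).
Proof.
rewrite -raddfD; apply: (pos_entries_order_unit limG) => m _ i.
by rewrite pushD push_U1 // push_U2.
Qed.

Let coord_orbit i (U : forall n, 'cV[int]_(J n + J n)) (s t : R) :
  (forall m, thread (U 0%N) m = U m) ->
  (forall m, `|coord i (U m) m - t| <= e m) ->
  coord i (U 0%N) m @[m --> \oo] --> s -> s = t.
Proof.
move=> UE Ut cvg_s; have cvg_t : coord i (U 0%N) m @[m --> \oo] --> t.
  apply: (@cvgn_of_approx _ _ d 1 _ 0%N d_cvg) => m _.
  rewrite distrC mul1r -(coord_push i _ (leq0n m.+1) (leqnn _)) UE.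
  by apply: le_trans (e_le_d m); exact: Ut.
by rewrite -(cvg_lim _ cvg_s) // (cvg_lim _ cvg_t).
Qed.

(** [U1 n] and [U2 n] have negative entries, so positivity of [tau] gives no immediate sign for
    [tau u1], [tau u2]; their lower bounds [- (2 * e m.+1)] tend to [0] instead. *)
Let state_decomposition (s1 s2 : {additive G -> R}) (tau : G -> R) :
  (forall n v, coord lft v m @[m --> \oo] --> s1 (eta n v)) ->
  (forall n v, coord rgt v m @[m --> \oo] --> s2 (eta n v)) ->
  states Gp (u1 + u2) tau ->
  [/\ 0 <= tau u1, 0 <= tau u2 &
      forall x, tau x = tau u1 * s1 x + tau u2 * s2 x].
Proof.
move=> s1E s2E [tau_add tau_ge0 tau_u].
pose T : {additive G -> R} :=
  HB.pack tau (GRing.isZmodMorphism.Build _ _ _ tau_add).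
have tau_u12 : tau u1 + tau u2 = 1 by rewrite -tau_u; exact/esym/(raddfD T).
have [N eN] := e_small.
(* The functional is [tau] composed with [eta m.+1]; its value on [u1 + u2] is [1], so the error is
   a constant times [d m]. *)
have est n (v : 'cV[int]_(J n + J n)) : simplicial_cone v -> exists c,
    forall m, (maxn n N <= m)%N -> [/\ - (2 * e m.+1) <= tau u1,
      - (2 * e m.+1) <= tau u2 &
      `|tau (eta n v) - (tau u1 * coord lft v m.+1 + tau u2 * coord rgt v m.+1)|
        <= 2 * c * d m].
  move=> v0; have [c c0 vc] := coord_bounded v; exists c => m.
  rewrite geq_max => /andP[nm Nm].
  have nm1 : (n <= m.+1)%N by rewrite leqW.
  have e4 : e m.+1 <= 4^-1 by rewrite eN // leqW.
  have [vl vr] := vc _ nm1 e4.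
  have := @estimate n v c m (tau \o eta m.+1) _ _ v0 nm e4 vl vr.
  rewrite /= eta_U1 eta_U2 (eta_push limG) // tau_u12 !mulr1; apply.
    by move=> x y /=; rewrite raddfB tau_add.
  by move=> w w0; apply: tau_ge0; exact: (eta_pos limG).
have e_to0 (x : R) : (forall m, (N <= m)%N -> - (2 * e m.+1) <= x) -> 0 <= x.
  move=> xN; have : - (2 * e m.+1) @[m --> \oo] --> (- (2 * 0) : R).
    by apply: cvgN; apply: cvgM; [exact: cvg_cst|rewrite (cvg_shiftS e)].
  rewrite mulr0 oppr0 => /cvgr_to_le; apply; near=> m; apply: xN.
  by near: m; exact: nbhs_infty_ge.
(* The lower bounds in [est] do not involve [v], so the zero vector serves to extract them. *)
have z0 : simplicial_cone (0 : 'cV[int]_(J 0 + J 0)) by move=> i; rewrite mxE.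
have [c cE] := est _ _ z0; rewrite max0n in cE.
have tauE n v : simplicial_cone v ->
    tau (eta n v) = tau u1 * s1 (eta n v) + tau u2 * s2 (eta n v).
  move=> v0; have [c' c'E] := est n v v0.
  have cvg_tau : tau u1 * coord lft v m + tau u2 * coord rgt v m
      @[m --> \oo] --> tau (eta n v).
    apply: (@cvgn_of_approx _ _ d (2 * c') _ (maxn n N) d_cvg) => m nm.
    by case: (c'E m nm).
  rewrite -(cvg_lim _ cvg_tau) //; apply: cvg_lim => //.
  by apply: cvgD; apply: cvgM; (exact: cvg_cst || exact: s1E || exact: s2E).
split=> [||x].
- by apply: e_to0 => m /cE[].
- by apply: e_to0 => m /cE[].
have [n [v ->]] := indlim_surj limG x; have [a [b [a0 b0 ->]]] := cV_pos_neg v.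
rewrite raddfB tau_add (tauE n a) // (tauE n b) // !raddfB !mulrBr opprD.
by rewrite addrACA.
Unshelve. all: by end_near. Qed.

Lemma two_block_states :
  (forall n, eta n (U1 n) = u1 /\ eta n (U2 n) = u2) /\
  simple_dimension_group Gp /\
  order_unit Gp (u1 + u2) /\
  exists s1 s2 : G -> R,
    [/\ s1 <> s2,
        extremal_states Gp (u1 + u2) = [set s1; s2],
        s1 u1 = 1 /\ s2 u2 = 1 &
        s2 u1 = 0 /\ s1 u2 = 0].
Proof.
have [s1 s1_ge0 s1E] := limit_state (fun n v => (is_cvg_coord v).1).
have [s2 s2_ge0 s2E] := limit_state (fun n v => (is_cvg_coord v).2).
have s11 : s1 u1 = 1.
  apply: (coord_orbit (i := lft) (U := U1)) => [m|m|]; last exact: s1E.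
    exact: push_U1.
  by case: (coord_lft_U m).
have s12 : s1 u2 = 0.
  apply: (coord_orbit (i := lft) (U := U2)) => [m|m|]; last exact: s1E.
    exact: push_U2.
  by rewrite subr0; case: (coord_lft_U m).
have s21 : s2 u1 = 0.
  apply: (coord_orbit (i := rgt) (U := U1)) => [m|m|]; last exact: s2E.
    exact: push_U1.
  by rewrite subr0; case: (coord_rgt_U m).
have s22 : s2 u2 = 1.
  apply: (coord_orbit (i := rgt) (U := U2)) => [m|m|]; last exact: s2E.
    exact: push_U2.
  by case: (coord_rgt_U m).
have state1 : states Gp (u1 + u2) s1.
  by split=> //; [exact: raddfB|rewrite raddfD /= s11 s12 addr0].
have state2 : states Gp (u1 + u2) s2.
  by split=> //; [exact: raddfB|rewrite raddfD /= s21 s22 add0r].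
split; first by move=> n; rewrite eta_U1 eta_U2.
split.
  apply: (simple_indlim limG B_ge0 _ B_gt0 state1) => n.
  by rewrite addn_gt0 J_gt0.
split; first exact: u_order_unit.
exists s1, s2; split=> //.
  by move=> s12E; have /eqP := oner_neq0 R; rewrite -s11 s12E s21.
(* Evaluation at [u1] is the coordinate on the segment of states: [tau u1] is the weight of [s1],
   and [tau u2 = 1 - tau u1] that of [s2]. *)
apply: (extreme_points_segment state1 state2 s11 s21) => tau tau_state.
have [t1 t2 tauE] := state_decomposition s1E s2E tau_state.
case: tau_state => tau_add _ tau_u.
pose T : {additive G -> R} :=
  HB.pack tau (GRing.isZmodMorphism.Build _ _ _ tau_add).
have tau_u2 : tau u2 = 1 - tau u1.
  by apply/eqP; rewrite eq_sym subr_eq addrC -tau_u; apply/eqP/(raddfD T).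
split; first by rewrite t1 -subr_ge0 -tau_u2.
by apply/funext => x; rewrite tauE tau_u2.
Qed.

End TwoBlockSystem.

(* Sequences are indexed from 0 instead of 1. *)
Theorem theorem1p3 (R : realType) (J : nat -> nat)
  (u11 u12 u21 u22 : forall n, 'cV[int]_(J n))
  (A11 A12 A21 A22 : forall n, 'M[int]_(J n.+1, J n))
  (G : zmodType) (Gp : set G)
  (eta : forall n, {additive 'cV[int]_(J n + J n) -> G})
  (r : nat -> rat) (K l : nat -> nat) :
  (forall n, (0 < J n)%N) ->
  (forall n i j, [/\ 0 < A11 n i j, 0 < A12 n i j,
                     0 < A21 n i j & 0 < A22 n i j]) ->
  (forall n, block_mx (A11 n) (A12 n) (A21 n) (A22 n)
               *m col_mx (u11 n) (u12 n) = col_mx (u11 n.+1) (u12 n.+1)) ->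
  (forall n, block_mx (A11 n) (A12 n) (A21 n) (A22 n)
               *m col_mx (u21 n) (u22 n) = col_mx (u21 n.+1) (u22 n.+1)) ->
  inductive_limit (I := fun n => (J n + J n)%N)
    (fun n => block_mx (A11 n) (A12 n) (A21 n) (A22 n)) Gp eta ->
  (forall n, r n.+1 <= r n) ->
  (forall n, 1 < r n < 2) ->
  (ratr (r n) : R) @[n --> \oo] --> (1 : R) ->
  (forall n, (K n < K n.+1)%N) ->
  (forall n, (l n < l n.+1)%N) ->
  (forall n, (4 <= K n)%N) ->
  (forall n, (4 <= l n)%N) ->
  (forall n i,
    [/\ (r n)^-1 * (K n)%:R <= (u11 n i ord0)%:~R <= r n * (K n)%:R,
        (r n)^-1 * (K n)%:R <= (u22 n i ord0)%:~R <= r n * (K n)%:R,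
        - (r n * (K n)%:R) <= (l n)%:R * (u12 n i ord0)%:~R
                           <= - ((r n)^-1 * (K n)%:R) &
        - (r n * (K n)%:R) <= (l n)%:R * (u21 n i ord0)%:~R
                           <= - ((r n)^-1 * (K n)%:R)]) ->
  (forall n (j' j'' : 'I_(J n.+1)) (j : 'I_(J n)),
    (r n)^-1 * (A11 n j' j)%:~R <= (l n)%:R * (A21 n j'' j)%:~R
                                <= r n * (A11 n j' j)%:~R /\
    (r n)^-1 * (A22 n j' j)%:~R <= (l n)%:R * (A12 n j'' j)%:~R
                                <= r n * (A22 n j' j)%:~R) ->
  let u1 := eta 0%N (col_mx (u11 0%N) (u12 0%N)) in
  let u2 := eta 0%N (col_mx (u21 0%N) (u22 0%N)) in
  (forall n, eta n (col_mx (u11 n) (u12 n)) = u1 /\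
             eta n (col_mx (u21 n) (u22 n)) = u2) /\
  simple_dimension_group Gp /\
  order_unit Gp (u1 + u2) /\
  exists s1 s2 : G -> R,
    [/\ s1 <> s2,
        extremal_states Gp (u1 + u2) = [set s1; s2],
        s1 u1 = 1 /\ s2 u2 = 1 &
        s2 u1 = 0 /\ s1 u2 = 0].
Proof.
move=> J_gt0 A_gt0 BU1 BU2 limG r_decr r_bound r_cvg _ l_incr K_ge4 l_ge4.
move=> u_bound A_bound; apply: (two_block_states (R := R) (r := ratr \o r)
  (K := K) (l := l)) => //=.
- by move=> n; rewrite ler_rat.
- by move=> n; have := r_bound n; rewrite -!(ltr_rat R) rmorph1 ratr_nat.
- move=> n i; have := u_bound n i; rewrite -!(ler_rat R).
  by rewrite !(rmorphN, rmorphM, fmorphV, rmorph_int, rmorph_nat).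
- move=> n j' j'' j; have := A_bound n j' j'' j.
  by rewrite -!(ler_rat R) !(rmorphM, fmorphV, rmorph_int, rmorph_nat).
Qed.
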